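(* Let $n\ge 2$, let the symmetric group $S_n$ act naturally on $[n]=\{1,\dots,n\}$, and let $V$ and $V^-$ be the $S_n$-modules corresponding to the irreducible representations $\rho^a_{(S_n;[n])}$ and $\rho^a_{(S_n;[n])}\otimes \mathbf 1^-_{S_n}$, respectively, where $\mathbf 1^-_{S_n}$ is the sign representation. Assume that $n$ is odd. Then there exists an admissible $2$-homogeneous $S_n$-equivariant map from $V^-$ to $V$.
   Context: All representations are finite-dimensional complex representations. $\rho^a_{(S_n;[n])}$ is the augmentation representation: the complement of the trivial representation in the complex permutation representation, i.e. $S_n$ permuting coordinates on $\{z\in\mathbb C^n:\sum_i z_i=0\}$. A map $f:X\to Y$ between representations of $G$ is equivariant if $f(gx)=gf(x)$ for all $g\in G$, $x\in X$; it is admissible if moreover $f^{-1}(0)=\{0\}$. A map is $2$-homogeneous if in linear coordinates each of its components is a homogeneous polynomial of degree $2$ (a complex quadratic map). *)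

(* Defs.v *)
From HB Require Import structures.
From mathcomp Require Import all_boot all_order all_algebra all_fingroup.
From mathcomp Require Import all_character.
From mathcomp Require Import mpoly.
From mathcomp Require Import reals complex.

Set Implicit Arguments.
Unset Strict Implicit.
Unset Printing Implicit Defensive.

Import GroupScope GRing.Theory.
Local Open Scope ring_scope.

(* MathComp representations act on row vectors from the right, x |-> x *m rG g,
   and permutations compose accordingly: (s * t) i = t (s i). The left action
   of the text is g . x := x *m rG g^-1; being equivariant for all g in G means
   the same thing for either action. *)

Section Maps.

Variables (F : fieldType) (gT : finGroupType) (G : {group gT}).
Variables (d1 d2 : nat).

Definition equivariant (rG1 : mx_representation F G d1)
    (rG2 : mx_representation F G d2) (f : 'rV[F]_d1 -> 'rV[F]_d2) : Prop :=
  forall g, g \in G -> forall x, f (x *m rG1 g) = f x *m rG2 g.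

Definition admissible (rG1 : mx_representation F G d1)
    (rG2 : mx_representation F G d2) (f : 'rV[F]_d1 -> 'rV[F]_d2) : Prop :=
  equivariant rG1 rG2 f /\ forall x, f x = 0 <-> x = 0.

Definition homogeneous_map (k : nat) (f : 'rV[F]_d1 -> 'rV[F]_d2) : Prop :=
  exists P : 'I_d2 -> {mpoly F[d1]},
    (forall i, P i \is k.-homog) /\
    (forall x i, f x 0 i = (P i).@[fun j => x 0 j]).

End Maps.

Section SymmetricGroup.

Variables (F : fieldType) (n : nat).

Lemma perm_mx_repr : mx_repr [set: 'S_n] (fun s : 'S_n => perm_mx s : 'M[F]_n).
Proof. by split=> [|s t _ _]; rewrite ?perm_mx1 ?perm_mxM. Qed.

(* The basis vector e_i is sent by s to e_(s i). *)
Definition perm_repr : mx_representation F [set: 'S_n] n :=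
  MxRepresentation perm_mx_repr.

(* The row space of sum0_mx is {z | \sum_i z_i = 0}. *)
Definition sum0_mx : 'M[F]_n := kermx (const_mx 1 : 'cV[F]_n).

Lemma sum0_mxP (z : 'rV[F]_n) : (z <= sum0_mx)%MS = (\sum_i z 0 i == 0).
Proof.
have E : z *m (const_mx 1 : 'cV[F]_n) = (\sum_i z 0 i)%:M.
  apply/matrixP=> i j; rewrite !ord1 !mxE mulr1n.
  by apply: eq_bigr => k _; rewrite mxE mulr1.
apply/sub_kermxP/eqP; rewrite E; last by move->; rewrite raddf0.
by move/matrixP/(_ 0 0); rewrite !mxE mulr1n.
Qed.

Lemma sum0_mx_module : mxmodule perm_repr sum0_mx.
Proof.
apply/mxmoduleP=> s _ /=; apply/sub_kermxP; rewrite -mulmxA.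
have -> : perm_mx s *m const_mx 1 = const_mx 1 :> 'cV[F]_n.
  by rewrite -row_permE; apply/matrixP=> i j; rewrite !mxE.
exact: mulmx_ker.
Qed.

Definition aug_repr : mx_representation F [set: 'S_n] (\rank sum0_mx) :=
  submod_repr sum0_mx_module.

Lemma sign_mx_repr :
  mx_repr [set: 'S_n] (fun s : 'S_n => ((-1) ^+ s)%:M : 'M[F]_1).
Proof.
split=> [|s t _ _]; first by rewrite odd_perm1.
by rewrite odd_permM signr_addb scalar_mxM.
Qed.

Definition sign_repr : mx_representation F [set: 'S_n] 1 :=
  MxRepresentation sign_mx_repr.

Definition aug_sign_repr :
    mx_representation F [set: 'S_n] (\rank sum0_mx * 1) :=
  prod_repr aug_repr sign_repr.

End SymmetricGroup.

(* Main.v *)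
Require Import Defs.
From mathcomp Require Import all_boot all_order all_algebra all_fingroup.
From mathcomp Require Import all_character.
From mathcomp Require Import mpoly.
From mathcomp Require Import reals complex.
Local Open Scope ring_scope.

Set Implicit Arguments.
Unset Strict Implicit.
Unset Printing Implicit Defensive.

Import Order.TTheory GRing.Theory Num.Theory.

(** Twisting by the sign does not affect a homogeneous map of even degree, so it
    suffices to find a quadratic equivariant self-map of V.  Take
    [z |-> (z_i ^ 2 - n^-1 * \sum_j z_j ^ 2)_i].  If it vanishes at z, then all
    the z_i ^ 2 coincide, so [z_i = +-z_0]; since [\sum_i z_i = 0] and a sum of an
    odd number of signs is nonzero, z = 0. *)

(** Both recursions, over columns in [trow] and over rows in [tprod], peel off blocks of size one,
    so each induction only tracks an index through the cast from [m * 1] to [m]. *)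
Lemma tprod_scalar_mx1 (F : fieldType) (m n : nat) (A : 'M[F]_(m, n)) (a : F)
    (i : 'I_(m * 1)) (j : 'I_(n * 1)) :
  tprod A (a%:M : 'M_1) i j =
  a * A (cast_ord (muln1 m) i) (cast_ord (muln1 n) j).
Proof.
have trow1 (k : nat) (u : 'rV[F]_k) (i0 : 'I_1) (l : 'I_(k * 1)) :
    trow u (a%:M : 'M_1) i0 l = a * u 0 (cast_ord (muln1 k) l).
  elim: k u l => [|k IH] u l /=; first by case: l.
  rewrite mxE; case: splitP => l' ll'.
    rewrite !ord1 !mxE mulr1n mulrC; congr (_ * u _ _); apply: val_inj.
    by rewrite /= ll' ord1.
  by rewrite IH mxE; congr (_ * u _ _); apply: val_inj; rewrite /= ll'.
elim: m A i => [|m IH] A i /=; first by case: i.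
rewrite mxE; case: splitP => i' ii'.
  rewrite trow1 mxE; congr (_ * A _ _); apply: val_inj.
  by rewrite /= ii' ord1.
by rewrite IH mxE; congr (_ * A _ _); apply: val_inj; rewrite /= ii'.
Qed.

(** Lets the action on $V^-$, built as a tensor product, be read as the action on $V$ multiplied by
    a sign. *)
Lemma mulmx_tprod_scalar_mx1 (F : fieldType) (m n : nat) (x : 'rV[F]_(m * 1))
    (A : 'M[F]_(m, n)) (a : F) :
  castmx (erefl, muln1 n) (x *m tprod A (a%:M : 'M_1)) =
  a *: (castmx (erefl, muln1 m) x *m A).
Proof.
apply/rowP=> j; rewrite castmxE !mxE mulr_sumr.
rewrite (reindex (cast_ord (esym (muln1 m)))) /=; last first.
  by exists (cast_ord (muln1 m)) => k _; rewrite ?cast_ordK ?cast_ordKV.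
apply: eq_bigr => k _; rewrite tprod_scalar_mx1 castmxE cast_ordKV.
by rewrite cast_ordKV mulrCA !cast_ord_id.
Qed.

Section CenteredSquares.

Variables (F : numFieldType) (n : nat).

(** For [0 < n], this is the coordinatewise square projected onto the sum-zero hyperplane along the
    constant vectors. *)
Definition centered_sqr (z : 'rV[F]_n) : 'rV[F]_n :=
  \row_i (z 0 i ^+ 2 - n%:R^-1 * \sum_j z 0 j ^+ 2).

Lemma centered_sqrZ (a : F) (z : 'rV[F]_n) :
  centered_sqr (a *: z) = a ^+ 2 *: centered_sqr z.
Proof.
apply/rowP=> i; rewrite !mxE mulrBr exprMn (mulrCA _ n%:R^-1); congr (_ - _ * _).
by rewrite mulr_sumr; apply: eq_bigr => j _; rewrite mxE exprMn.
Qed.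

Lemma centered_sqr_perm (s : 'S_n) (z : 'rV[F]_n) :
  centered_sqr (z *m perm_mx s) = centered_sqr z *m perm_mx s.
Proof.
(* [col_permE] is stated for the matrix of an inverse permutation, hence the double inverse. *)
rewrite -[s]invgK -!col_permE; apply/rowP=> i; rewrite !mxE.
congr (_ - _ * _); rewrite [RHS](reindex_inj (@perm_inj _ s^-1)) /=.
by apply: eq_bigr => j _; rewrite mxE.
Qed.

Lemma centered_sqr_sum0 (z : 'rV[F]_n) :
  (0 < n)%N -> (centered_sqr z <= sum0_mx F n)%MS.
Proof.
move=> n_gt0; rewrite sum0_mxP.
under eq_bigr do rewrite mxE.
rewrite sumrB sumr_const card_ord -[_ *+ n]mulr_natl mulVKf ?subrr //.
by rewrite pnatr_eq0 -lt0n.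
Qed.

Lemma odd_sum_sqr_const_eq0 (z : 'rV[F]_n) (c : F) :
  odd n -> (forall i, z 0 i ^+ 2 = c) -> \sum_i z 0 i = 0 -> z = 0.
Proof.
move=> n_odd zc z0.
have i0 : 'I_n by exists 0%N; case: (n) n_odd.
have zV i : z 0 i != z 0 i0 -> z 0 i = - z 0 i0.
  by move/negbTE=> ne; apply/eqP; move: (eqf_sqr (z 0 i) (z 0 i0)); rewrite !zc eqxx ne.
pose P := [pred i | z 0 i == z 0 i0].
(* The zero sum is split by sign: entries equal to [z 0 i0] must cancel those equal to its
   opposite. *)
have : #|P|%:R * z 0 i0 = #|predC P|%:R * z 0 i0.
  apply/eqP; rewrite -subr_eq0 -z0 (bigID P) /= !mulr_natl -mulNrn.
  rewrite -!sumr_const; apply/eqP; congr (_ + _).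
    by apply: eq_bigr => i /eqP.
  by apply: eq_bigr => i /zV.
have [z00 _ | nz /(mulIf nz)/eqP] := eqVneq (z 0 i0) 0.
  apply/rowP=> i; rewrite mxE; apply/eqP.
  by rewrite -sqrf_eq0 zc -(zc i0) z00 expr0n.
(* Characteristic zero turns the equality in [F] into one of cardinals, so [n] would be twice
   [#|P|]. *)
rewrite eqr_nat => /eqP ePC; have := cardC P.
by rewrite card_ord ePC addnn => n2; rewrite -n2 odd_double in n_odd.
Qed.

Lemma centered_sqr_eq0 (z : 'rV[F]_n) :
  odd n -> (z <= sum0_mx F n)%MS -> centered_sqr z = 0 -> z = 0.
Proof.
rewrite sum0_mxP => n_odd /eqP z0 /rowP qz.
apply: (@odd_sum_sqr_const_eq0 z (n%:R^-1 * \sum_j z 0 j ^+ 2)) => // i.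
by apply/eqP; rewrite -subr_eq0; have := qz i; rewrite !mxE => ->.
Qed.

End CenteredSquares.

Section QuadraticMap.

Variables (F : numFieldType) (n : nat).

Local Notation W := (sum0_mx F n).

(** Elements of $V^-$ are coordinate rows in the basis [row_base W]; this embeds them in the ambient
    space, where the quadratic map has a simple formula. *)
Definition aug_coord (x : 'rV[F]_(\rank W * 1)) : 'rV[F]_n :=
  val_submod (castmx (erefl, muln1 _) x).

Definition aug_quadratic_map (x : 'rV[F]_(\rank W * 1)) : 'rV[F]_(\rank W) :=
  in_submod W (centered_sqr (aug_coord x)).

Lemma aug_coord_eq0 x : aug_coord x = 0 -> x = 0.
Proof.
move/eqP; rewrite val_submod_eq0 => /eqP/(canRL (castmxK _ _)) ->.
by apply/rowP=> i; rewrite castmxE !mxE.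
Qed.

Lemma aug_coord_perm x (s : 'S_n) :
  aug_coord (x *m aug_sign_repr F n s) =
  (-1) ^+ s *: (aug_coord x *m perm_mx s).
Proof.
rewrite /aug_coord /= mulmx_tprod_scalar_mx1 linearZ /=.
by rewrite (val_submodJ (sum0_mx_module F n)) // inE.
Qed.

Lemma aug_quadratic_map_equivariant :
  (0 < n)%N ->
  equivariant (aug_sign_repr F n) (aug_repr F n) aug_quadratic_map.
Proof.
move=> n_gt0 s _ x; rewrite /aug_quadratic_map aug_coord_perm.
(* The sign comes out squared, so it disappears. *)
rewrite centered_sqrZ sqrr_sign scale1r centered_sqr_perm.
exact: (in_submodJ (sum0_mx_module F n) s (centered_sqr_sum0 _ n_gt0)).
Qed.

Lemma aug_quadratic_map_eq0 x : odd n -> aug_quadratic_map x = 0 <-> x = 0.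
Proof.
move=> n_odd; have n_gt0 := odd_gt0 n_odd; split=> [fx0 | ->]; last first.
  rewrite /aug_quadratic_map; suff -> : aug_coord 0 = 0.
    by rewrite -(scale0r (0 : 'rV_n)) centered_sqrZ expr0n scale0r linear0.
  rewrite /aug_coord -[RHS](linear0 (val_submod (U := W) (m := 1))).
  by congr val_submod; apply/rowP=> i; rewrite castmxE !mxE.
apply: aug_coord_eq0; apply: centered_sqr_eq0 => //; first exact: val_submodP.
(* [in_submod] can be undone here because the centered squares lie in [W]. *)
by rewrite -(in_submodK (centered_sqr_sum0 _ n_gt0)) [in_submod _ _]fx0 linear0.
Qed.

Lemma aug_quadratic_map_homogeneous : homogeneous_map 2 aug_quadratic_map.
Proof.
(* [L k] is the [k]-th ambient coordinate as a linear form in the coordinates on $V^-$. *)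
pose L k : {mpoly F[\rank W * 1]} :=
  \sum_j row_base W j k *: 'X_(cast_ord (esym (muln1 _)) j).
have L2 k : L k ^+ 2 \is 2.-homog.
  apply: (@dhomogMn _ _ _ 1%N); apply: rpred_sum => j _; apply: rpredZ.
  by rewrite dhomogX /= mdeg1.
have LE (x : 'rV_(\rank W * 1)) k : (L k).@[fun j => x 0 j] = aug_coord x 0 k.
  rewrite raddf_sum mxE; apply: eq_bigr => j _ /=.
  by rewrite mevalZ mevalXU castmxE mulrC cast_ord_id.
pose Q k : {mpoly F[\rank W * 1]} := L k ^+ 2 - n%:R^-1 *: \sum_j L j ^+ 2.
(* [B] is the matrix of the linear map [in_submod W], so each component of the map is a linear
   combination of the quadratic forms [Q k]. *)
pose B : 'M_(n, \rank W) := in_submod W 1%:M.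
exists (fun i => \sum_k B k i *: Q k); split=> [i | x i].
  apply: rpred_sum => k _; apply/rpredZ/rpredB => //.
  by apply: rpredZ; apply: rpred_sum.
rewrite /aug_quadratic_map in_submodE mxE raddf_sum; apply: eq_bigr => k _ /=.
rewrite mevalZ mevalB mevalZ rmorphXn /= LE raddf_sum mxE mulrC.
congr (_ * (_ - _ * _)); apply: eq_bigr => j _.
by rewrite /= rmorphXn /= LE.
Qed.

End QuadraticMap.

Theorem theorem6p9 (R : realType) (n : nat) (hn : (2 <= n)%N) (hodd : odd n) :
  exists f : 'rV[R[i]]_(\rank (sum0_mx R[i] n) * 1) ->
             'rV[R[i]]_(\rank (sum0_mx R[i] n)),
    admissible (aug_sign_repr R[i] n) (aug_repr R[i] n) f /\
    homogeneous_map 2 f.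
Proof.
exists (@aug_quadratic_map _ n); split; last exact: aug_quadratic_map_homogeneous.
split; [exact/aug_quadratic_map_equivariant/odd_gt0 | move=> x; exact: aug_quadratic_map_eq0].
Qed.
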